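(* Let $G$ be a split graph with a split partition $(K,I)$ such that $I$ is a maximal independent set. Then: \begin{enumerate} \item If $K$ is not a maximal clique in $G$, then $I$ is a maximum minimal clique transversal in $G$; in particular, $\tau_c^+(G)=\alpha(G)$ in this case. \item If $K$ is a maximal clique in $G$, then for every vertex $v\in K$ with the smallest number of neighbors in $I$ (among vertices of $K$), the set $\{v\}\cup (I\setminus N(v))$ is a maximum minimal clique transversal in $G$; in particular, $\tau_c^+(G)=\alpha(G)-\delta_G(I,K)+1$ in this case, where $\delta_G(I,K)=\min\{|N(v)\cap I| : v\in K\}$. \end{enumerate} Consequently, every split graph $G$ satisfies $\tau_c^+(G)\le \alpha(G)$.
   Context: All graphs are finite, simple, undirected, and have at least one vertex. $N(v)$ denotes the set of vertices adjacent to $v$. A clique is a set of pairwise adjacent vertices and an independent set is a set of pairwise non-adjacent vertices; each is maximal if not properly contained in another such set. $\alpha(G)$ is the independence number of $G$, the maximum size of an independent set. A split graph is a graph $G$ that has a split partition $(K,I)$: $K$ is a clique, $I$ is an independent set, $K\cap I=\emptyset$, and $K\cup I=V(G)$. A clique transversal in $G$ is a set of vertices intersecting every maximal clique of $G$; it is minimal if it does not contain any other clique transversal. The upper clique transversal number $\tau_c^+(G)$ is the maximum size of a minimal clique transversal in $G$; a maximum minimal clique transversal is a minimal clique transversal of size $\tau_c^+(G)$. *)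

(* Defs.v *)
From mathcomp Require Import all_boot.

Set Implicit Arguments.
Unset Strict Implicit.
Unset Printing Implicit Defensive.

Record sgraph := SGraph {
  vertex :> finType;
  adj : rel vertex;
  adj_sym : symmetric adj;
  adj_irr : irreflexive adj;
  vertex_gt0 : 0 < #|vertex|
}.

Definition nbhd (G : sgraph) (v : G) : {set G} := [set u | adj v u].

Definition clique (G : sgraph) (S : {set G}) : bool :=
  [forall x in S, forall y in S, (x != y) ==> adj x y].

Definition independent (G : sgraph) (S : {set G}) : bool :=
  [forall x in S, forall y in S, ~~ adj x y].

Definition maximal_clique (G : sgraph) (S : {set G}) : bool :=
  maxset (@clique G) S.

Definition maximal_independent (G : sgraph) (S : {set G}) : bool :=
  maxset (@independent G) S.

Definition independence_number (G : sgraph) : nat :=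
  \max_(S : {set G} | independent S) #|S|.

Definition split_partition (G : sgraph) (K I : {set G}) : bool :=
  [&& clique K, independent I, K :&: I == set0 & K :|: I == [set: G]].

Definition split_graph (G : sgraph) : Prop :=
  exists K I : {set G}, split_partition K I.

Definition clique_transversal (G : sgraph) (S : {set G}) : bool :=
  [forall C : {set G}, maximal_clique C ==> (S :&: C != set0)].

Definition minimal_clique_transversal (G : sgraph) (S : {set G}) : bool :=
  minset (@clique_transversal G) S.

(* The maximum ranges over a nonempty family: as G has a vertex, its maximal
   cliques are nonempty, so its vertex set is a clique transversal. *)
Definition upper_clique_transversal_number (G : sgraph) : nat :=
  \max_(S : {set G} | minimal_clique_transversal S) #|S|.

Definition maximum_minimal_clique_transversal (G : sgraph) (S : {set G}) : bool :=
  minimal_clique_transversal S && (#|S| == upper_clique_transversal_number G).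

(* delta_G(I, K), the minimum of |N(v) :&: I| over v in K. The initial value
   #|I| bounds every term, so it matters only when K is empty. *)
Definition min_nbrs (G : sgraph) (I K : {set G}) : nat :=
  \big[minn/#|I|]_(v in K) #|nbhd v :&: I|.

(* Main.v *)
(** Write $N[i]$ for the closed neighbourhood of $i$. In a split graph the
    maximal cliques are the sets $N[i]$ for $i \in I$, together with $K$ when
    $K$ is itself maximal. A clique transversal $T$ is minimal exactly when each
    $t \in T$ has a private maximal clique, one that meets $T$ only in $t$. If
    $K$ is not maximal this injects $T$ into $I$. If $K$ is maximal, $T$ contains
    some $u \in K$; the private cliques of the other elements avoid $u$, hence
    are $N[i]$ with $i \in I \setminus N(u)$, and
    $|T| \le 1 + |I \setminus N(u)|$. *)

From HB Require Import structures.
Require Import Defs.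
From mathcomp Require Import all_boot.

Set Implicit Arguments.
Unset Strict Implicit.
Unset Printing Implicit Defensive.

Definition closed_nbhd (G : sgraph) (v : G) : {set G} := v |: nbhd v.

Lemma in_nbhd (G : sgraph) (u v : G) : (u \in nbhd v) = adj v u.
Proof. by rewrite inE. Qed.

Lemma in_closed_nbhd (G : sgraph) (u v : G) :
  (u \in closed_nbhd v) = (u == v) || adj v u.
Proof. by rewrite !inE. Qed.

Lemma cliqueP (G : sgraph) (S : {set G}) :
  reflect {in S &, forall x y, x != y -> adj x y} (clique S).
Proof.
apply: (iffP forall_inP) => [cl x y xS yS|cl x xS].
  by move/forall_inP: (cl x xS) => /(_ y yS) /implyP.
by apply/forall_inP => y yS; apply/implyP; apply: cl.
Qed.

Lemma independentP (G : sgraph) (S : {set G}) :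
  reflect {in S &, forall x y, ~~ adj x y} (independent S).
Proof.
apply: (iffP forall_inP) => [ind x y xS yS|ind x xS].
  by move/forall_inP: (ind x xS) => /(_ y yS).
by apply/forall_inP => y yS; apply: ind.
Qed.

Lemma clique_transversalP (G : sgraph) (S : {set G}) :
  reflect (forall C, maximal_clique C -> exists2 x, x \in S & x \in C)
          (clique_transversal S).
Proof.
apply: (iffP forallP) => tr C; last first.
  apply/implyP => /tr [x xS xC].
  by apply/set0Pn; exists x; rewrite inE xS.
move/(implyP (tr C)) => /set0Pn [x].
by rewrite inE => /andP [xS xC]; exists x.
Qed.

(** If [t] has no private clique, [T :\ t] still meets every maximal clique. Conversely, a
    transversal inside [T] can meet the private clique of [t] only in [t]. *)
Lemma minimal_clique_transversalP (G : sgraph) (T : {set G}) :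
  reflect (clique_transversal T /\
           forall t, t \in T ->
             exists2 C, maximal_clique C & T :&: C = [set t])
          (minimal_clique_transversal T).
Proof.
apply: (iffP minsetP) => [[trT minT]|[trT priv]]; split=> //.
  move=> t tT; have [/forall_inP hit|] := boolP [forall C in @maximal_clique G,
                              (T :\ t) :&: C != set0].
    have trTt : clique_transversal (T :\ t).
      by apply/forallP => C; apply/implyP; apply: hit.
    by have := minT _ trTt (subD1set T t); move/setP/(_ t); rewrite !inE eqxx tT.
  case/forall_inPn => C maxC; rewrite negbK => /eqP TtC; exists C => //.
  have [x xT xC] := clique_transversalP T trT C maxC.
  have only y : y \in T -> y \in C -> y = t.
    move=> yT yC; apply/eqP; apply: contraTT isT => yt.
    by move/setP: TtC => /(_ y); rewrite !inE yt yT yC.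
  apply/setP => y; rewrite !inE; apply/andP/eqP => [[yT yC]|->].
    exact: only.
  by rewrite -(only x xT xC).
move=> S trS sST; apply/eqP; rewrite eqEsubset sST.
apply/subsetP => t /priv [C maxC TC].
have [x xS xC] := clique_transversalP S trS C maxC.
have: x \in T :&: C by rewrite inE (subsetP sST).
by rewrite TC => /set1P <-.
Qed.

(* The singletons [set t] are among the values of the map i |-> T :&: N[i]. *)
Lemma leq_card_private (G : sgraph) (T S J : {set G}) :
  (forall t, t \in S ->
     exists2 i, i \in J & T :&: closed_nbhd i = [set t]) ->
  #|S| <= #|J|.
Proof.
move=> priv; rewrite -(card_imset (mem S) (@set1_inj G)).
apply: leq_trans (leq_imset_card (fun i => T :&: closed_nbhd i) (mem J)).
apply/subset_leq_card/subsetP => _ /imsetP [t tS ->].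
by have [i iJ <-] := priv t tS; apply: imset_f.
Qed.

(** * Maximal cliques of a split graph *)

Lemma split_partitionP (G : sgraph) (K I : {set G}) :
  reflect [/\ clique K, independent I & K = ~: I] (split_partition K I).
Proof.
apply: (iffP and4P) => [[clK indI /eqP KI0 /eqP KIT]|[clK indI KE]].
  split=> //; apply/setP => x; rewrite inE.
  move/setP: KI0 => /(_ x); move/setP: KIT => /(_ x); rewrite !inE.
  by case: (x \in K) (x \in I) => [] [].
by split=> //; rewrite KE 1?setIC 1?setUC ?setICr ?setUCr.
Qed.

(** All neighbours of [i] lie in the clique [K], and any clique containing [i] stays inside
    $N[i]$. *)
Lemma maximal_clique_closed_nbhd (G : sgraph) (K I : {set G}) (i : G) :
  split_partition K I -> i \in I -> maximal_clique (closed_nbhd i).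
Proof.
case/split_partitionP => /cliqueP clK /independentP indI KE iI.
have nK x : adj i x -> x \in K.
  move=> ix; rewrite KE inE; apply/negP => xI.
  by have := indI i x iI xI; rewrite ix.
apply/maxsetP; split.
  apply/cliqueP => x y; rewrite !in_closed_nbhd.
  case/predU1P => [->|ix] /predU1P [->|iy] xy //; first by rewrite eqxx in xy.
    by rewrite adj_sym.
  by apply: clK => //; apply: nK.
move=> C /cliqueP clC sC; apply/eqP; rewrite eqEsubset sC andbT.
have iC : i \in C by rewrite (subsetP sC) // in_closed_nbhd eqxx.
apply/subsetP => x xC; rewrite in_closed_nbhd; case: eqVneq => //= xi.
by apply: clC => //; rewrite eq_sym.
Qed.

(** If [C] misses [I], it lies in the clique [K]; if it contains some [i] of [I], it lies in the
    clique $N[i]$. Maximality of [C] gives equality. *)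
Lemma maximal_clique_split (G : sgraph) (K I C : {set G}) :
  split_partition K I -> maximal_clique C ->
  C = K \/ exists2 i, i \in I & C = closed_nbhd i.
Proof.
case/split_partitionP => clK indI KE /maxsetP [/cliqueP clC maxC].
have [/pred0P CI0|/pred0Pn [i /andP [iC iI]]] :=
  boolP (pred0b [predI C & I]).
  left; apply/esym/maxC => //.
  apply/subsetP => x xC; rewrite KE inE.
  by have := CI0 x; rewrite /= xC => /= ->.
right; exists i => //; apply/esym/maxC.
  have sp : split_partition K I by apply/split_partitionP.
  by case/maxsetP: (maximal_clique_closed_nbhd sp iI).
apply/subsetP => x xC; rewrite in_closed_nbhd; case: eqVneq => //= xi.
by apply: clC => //; rewrite eq_sym.
Qed.

(** * The independence number *)

Lemma maximal_independent_nbr (G : sgraph) (I : {set G}) (v : G) :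
  maximal_independent I -> v \notin I -> 0 < #|nbhd v :&: I|.
Proof.
case/maxsetP => /independentP indI maxI vI; rewrite card_gt0.
apply: contra vI => /eqP nI0.
have nvI x : x \in I -> ~~ adj v x.
  by move=> xI; move/setP: nI0 => /(_ x); rewrite !inE xI andbT => ->.
rewrite -(maxI (v |: I)) ?setU11 ?subsetUr //.
apply/independentP => x y /setU1P [->|xI] /setU1P [->|yI].
- by rewrite adj_irr.
- exact: nvI.
- by rewrite adj_sym nvI.
- exact: indI.
Qed.

(** An independent set not inside [I] has exactly one vertex [v] in [K]; its other vertices avoid
    $N(v)$, and [v] is paid for by a neighbour in [I]. *)
Lemma independence_number_split (G : sgraph) (K I : {set G}) :
  split_partition K I -> maximal_independent I ->
  independence_number G = #|I|.
Proof.
case/split_partitionP => /cliqueP clK indI KE maxI.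
apply/eqP; rewrite eqn_leq andbC leq_bigmax_cond //=.
apply/bigmax_leqP => S /independentP indS.
have [SI|/subsetPn [v vS vI]] := boolP (S \subset I).
  exact: subset_leq_card.
have sS : S :\ v \subset I :\: nbhd v.
  apply/subsetP => x /setD1P [xv xS]; rewrite inE in_nbhd indS //=.
  apply: contraT => xI; have := indS x v xS vS.
  by rewrite clK // KE inE.
rewrite (cardsD1 v) vS -(cardsID (nbhd v) I) setIC.
by apply: leq_add (subset_leq_card sS); apply: maximal_independent_nbr.
Qed.

(** * Maximum minimal clique transversals in the two cases *)

Lemma maximum_minimal_clique_transversalI (G : sgraph) (T : {set G}) :
  minimal_clique_transversal T ->
  (forall S : {set G}, minimal_clique_transversal S -> #|S| <= #|T|) ->
  maximum_minimal_clique_transversal T.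
Proof.
move=> minT maxT; rewrite /maximum_minimal_clique_transversal minT /=.
rewrite eqn_leq leq_bigmax_cond //=.
by apply/bigmax_leqP.
Qed.

Lemma maximum_transversal_not_maximal (G : sgraph) (K I : {set G}) :
  split_partition K I -> ~~ maximal_clique K ->
  maximum_minimal_clique_transversal I.
Proof.
move=> sp nmaxK; have [_ /independentP indI _] := split_partitionP _ _ sp.
have maxCE C : maximal_clique C -> exists2 i, i \in I & C = closed_nbhd i.
  move=> maxC; case: (maximal_clique_split sp maxC) => // CK.
  by rewrite CK (negPf nmaxK) in maxC.
apply: maximum_minimal_clique_transversalI.
  apply/minimal_clique_transversalP; split.
    apply/clique_transversalP => C /maxCE [i iI ->].
    by exists i; rewrite // in_closed_nbhd eqxx.
  (* By independence of [I], the clique $N[i]$ is private to [i]. *)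
  move=> i iI; exists (closed_nbhd i).
    exact: maximal_clique_closed_nbhd sp iI.
  apply/setP => x; rewrite in_setI in_closed_nbhd in_set1.
  case: eqVneq => [->|_]; first by rewrite iI.
  by apply/negP => /andP [xI]; apply/negP; apply: indI.
move=> T /minimal_clique_transversalP [_ priv].
apply: (@leq_card_private _ T) => t /priv [C /maxCE [i iI ->] TC].
by exists i.
Qed.

(** Leaving [u] unspecified serves both the exact value, by comparison with a vertex of fewest
    neighbours in [I], and the general bound by the independence number. *)
Lemma card_minimal_transversal_le (G : sgraph) (K I T : {set G}) :
  split_partition K I -> maximal_clique K -> minimal_clique_transversal T ->
  exists2 u, u \in K & #|T| <= #|I :\: nbhd u|.+1.
Proof.
move=> sp maxK /minimal_clique_transversalP [/clique_transversalP trT priv].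
have [u uT uK] := trT K maxK; exists u => //.
rewrite (cardsD1 u) uT ltnS.
apply: (@leq_card_private _ T) => t /setD1P [tu /priv [C maxC TC]].
have uC : u \notin C.
  apply: contra tu => uC; have : u \in T :&: C by rewrite inE uT.
  by rewrite TC => /set1P ->.
case: (maximal_clique_split sp maxC) => [CK|[i iI CE]].
  by rewrite CK uK in uC.
exists i; last by rewrite -CE.
rewrite inE in_nbhd iI andbT adj_sym.
by apply: contra uC => iu; rewrite CE in_closed_nbhd iu orbT.
Qed.

(** The private cliques are [K] for [v] and $N[t]$ for each [t] in [I :\: nbhd v]. *)
Lemma minimal_transversal_maximal (G : sgraph) (K I : {set G}) (v : G) :
  split_partition K I -> maximal_clique K -> v \in K ->
  minimal_clique_transversal (v |: (I :\: nbhd v)).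
Proof.
move=> sp maxK vK; have [_ /independentP indI KE] := split_partitionP _ _ sp.
apply/minimal_clique_transversalP; split.
  apply/clique_transversalP => C /(maximal_clique_split sp) [->|[i iI ->]].
    by exists v; rewrite // setU11.
  have [vi|nvi] := boolP (adj v i).
    by exists v; rewrite ?setU11 // in_closed_nbhd adj_sym vi orbT.
  by exists i; rewrite ?in_closed_nbhd ?eqxx // !inE nvi iI orbT.
move=> t /setU1P [->|]; [exists K => //|].
  apply/setP => x; rewrite KE !inE; case: eqVneq => [->|_] /=.
    by rewrite KE inE in vK.
  by case: (x \in I); rewrite ?andbF.
rewrite inE in_nbhd => /andP [nvt tI]; exists (closed_nbhd t).
  exact: maximal_clique_closed_nbhd sp tI.
apply/setP => x; rewrite in_setI in_closed_nbhd !inE.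
case: (eqVneq x t) => [->|_] /=; first by rewrite nvt tI orbT.
apply/negP => /andP [/predU1P [->|/andP [_ xI]]].
  by rewrite adj_sym; apply/negP.
by apply/negP; apply: indI.
Qed.

Lemma maximum_transversal_maximal (G : sgraph) (K I : {set G}) (v : G) :
  split_partition K I -> maximal_clique K -> v \in K ->
  (forall u, u \in K -> #|nbhd v :&: I| <= #|nbhd u :&: I|) ->
  maximum_minimal_clique_transversal (v |: (I :\: nbhd v)).
Proof.
move=> sp maxK vK minv; have [_ _ KE] := split_partitionP _ _ sp.
apply: maximum_minimal_clique_transversalI.
  exact: minimal_transversal_maximal sp maxK vK.
move=> T minT.
have [u uK leT] := card_minimal_transversal_le sp maxK minT.
have vI : v \notin I by move: vK; rewrite KE inE.
rewrite cardsU1 inE (negPf vI) andbF add1n; apply: leq_trans leT _.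
by rewrite ltnS !cardsD leq_sub2l // ![I :&: _]setIC minv.
Qed.

(** * The numerical formula for maximal [K] *)

(** On [nat], [minn] has no neutral element; a commutative semigroup law is enough for [big_rem_AC]
    to extract the term of [v]. *)
HB.instance Definition _ := SemiGroup.isComLaw.Build nat minn minnA minnC.

Lemma min_nbrs_attained (G : sgraph) (I K : {set G}) (v : G) :
  v \in K -> (forall u, u \in K -> #|nbhd v :&: I| <= #|nbhd u :&: I|) ->
  min_nbrs I K = #|nbhd v :&: I|.
Proof.
move=> vK minv; rewrite /min_nbrs (big_rem_AC _ _ _ _ (mem_index_enum v)) vK.
(* The term of [v] is below the initial value [#|I|] and below every other term. *)
apply/minn_idPl; elim/big_rec: _ => [|u m uK lem].
  by rewrite subset_leq_card ?subsetIr.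
by rewrite leq_min minv.
Qed.

Lemma maximal_clique_neq0 (G : sgraph) (K : {set G}) :
  maximal_clique K -> K != set0.
Proof.
case/maxsetP => _ maxK; apply/negP => /eqP K0.
have [v _] := card_gt0P (vertex_gt0 G).
have cl1 : clique [set v].
  by apply/cliqueP => x y /set1P -> /set1P ->; rewrite eqxx.
have := maxK _ cl1; rewrite K0 sub0set => /(_ isT) /setP /(_ v).
by rewrite !inE eqxx.
Qed.

(** The truncated subtraction is exact: the independence number is [#|I|], and the minimum counts a
    subset of [I]. *)
Lemma upper_number_maximal (G : sgraph) (K I : {set G}) :
  split_partition K I -> maximal_independent I -> maximal_clique K ->
  upper_clique_transversal_number G =
    independence_number G - min_nbrs I K + 1.
Proof.
move=> sp maxI maxK; have [_ _ KE] := split_partitionP _ _ sp.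
have [w wK] := set0Pn _ (maximal_clique_neq0 maxK).
case: (@arg_minnP _ w [in K] (fun u => #|nbhd u :&: I|) wK) => v vK minv.
have /andP [_ /eqP <-] := maximum_transversal_maximal sp maxK vK minv.
have vI : v \notin I by move: vK; rewrite KE inE.
rewrite (min_nbrs_attained vK minv) (independence_number_split sp maxI).
by rewrite cardsU1 inE (negPf vI) andbF addnC cardsD [I :&: _]setIC.
Qed.

(** Enlarging [I] to a maximal independent set shrinks its complement, which remains a clique. *)
Lemma split_partition_maximal (G : sgraph) :
  split_graph G ->
  exists K I : {set G}, split_partition K I /\ maximal_independent I.
Proof.
case=> K [I /split_partitionP [/cliqueP clK indI KE]].
have [J maxJ sIJ] := maxset_exists indI.
exists (~: J), J; split=> //; apply/split_partitionP; split=> //.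
  apply/cliqueP => x y; rewrite !inE => xJ yJ.
  by apply: clK; rewrite KE inE; apply: contra (subsetP sIJ _) _.
by case/maxsetP: maxJ.
Qed.

Lemma upper_number_le_independence (G : sgraph) :
  split_graph G ->
  upper_clique_transversal_number G <= independence_number G.
Proof.
case/split_partition_maximal => K [I [sp maxI]].
have aE := independence_number_split sp maxI.
have [_ _ KE] := split_partitionP _ _ sp.
have [maxK|nmaxK] := boolP (maximal_clique K); last first.
  have /andP [_ /eqP <-] := maximum_transversal_not_maximal sp nmaxK.
  by rewrite aE.
apply/bigmax_leqP => T minT.
have [u uK leT] := card_minimal_transversal_le sp maxK minT.
(* The extra 1 is absorbed by [nbhd u :&: I], nonempty because [I] is maximal. *)
apply: leq_trans leT _; rewrite aE -(cardsID (nbhd u) I) -add1n leq_add2r setIC.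
by apply: maximal_independent_nbr; rewrite // KE inE in uK.
Qed.

Theorem theorem4p2 (G : sgraph) :
  (forall K I : {set G},
     split_partition K I -> maximal_independent I ->
     (~~ maximal_clique K ->
        maximum_minimal_clique_transversal I /\
        upper_clique_transversal_number G = independence_number G) /\
     (maximal_clique K ->
        (forall v : G, v \in K ->
           (forall u : G, u \in K -> #|nbhd v :&: I| <= #|nbhd u :&: I|) ->
           maximum_minimal_clique_transversal (v |: (I :\: nbhd v))) /\
        upper_clique_transversal_number G =
          independence_number G - min_nbrs I K + 1)) /\
  (split_graph G ->
     upper_clique_transversal_number G <= independence_number G).
Proof.
split; last exact: upper_number_le_independence.
move=> K I sp maxI; split=> [nmaxK|maxK]; split.
- exact: maximum_transversal_not_maximal sp nmaxK.
- have /andP [_ /eqP <-] := maximum_transversal_not_maximal sp nmaxK.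
  by rewrite (independence_number_split sp maxI).
- by move=> v; apply: maximum_transversal_maximal.
- exact: upper_number_maximal.
Qed.
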